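(* Let $\mathbf{C}$ be a dagger category (with zero morphisms) that admits polar decomposition and has dagger splittings of projections. If two objects $A_1$ and $A_2$ of $\mathbf{C}$ have a biproduct, then they have a dagger product as well.
   Context: A dagger category is a category $\mathbf{C}$ equipped with an identity-on-objects functor $\dagger\colon\mathbf{C}^{\mathrm{op}}\to\mathbf{C}$ satisfying $f^{\dagger\dagger}=f$. A morphism $f\colon A\to B$ is a partial isometry if $f=ff^\dagger f$, and dagger monic if $f^\dagger f=\mathrm{id}_A$. An endomorphism $f$ is self-adjoint if $f=f^\dagger$, and a projection if $f=f^\dagger=ff$. A bimorphism is a morphism that is both monic and epic. A polar decomposition of $f\colon A\to B$ consists of two factorizations $f=pi=jp$ where $p\colon A\to B$ is a partial isometry and $i\colon A\to A$, $j\colon B\to B$ are self-adjoint bimorphisms. $\mathbf{C}$ admits polar decomposition if every morphism has one. A dagger splitting of a projection $p\colon A\to A$ is a dagger monic $i\colon I\to A$ with $p=ii^\dagger$; $\mathbf{C}$ has dagger splittings of projections if every projection has one. In a category with zero morphisms $0_{X,Y}$, a biproduct of $A_1$ and $A_2$ is $(A_1\oplus A_2,p_1,p_2,i_1,i_2)$ where $(A_1\oplus A_2,p_1,p_2)$ is a product, $(A_1\oplus A_2,i_1,i_2)$ is a coproduct, and $p_1i_1=\mathrm{id}_{A_1}$, $p_2i_2=\mathrm{id}_{A_2}$, $p_2i_1=0_{A_1,A_2}$, $p_1i_2=0_{A_2,A_1}$. No compatibility of the biproduct with the dagger is assumed. A dagger product of $A_1$ and $A_2$ is a product $(P,q_1,q_2)$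 such that $q_1,q_2$ are partial isometries and $q_1^\dagger q_1q_2^\dagger q_2=q_2^\dagger q_2q_1^\dagger q_1$; in the presence of zero morphisms this is equivalent to being a product with $q_nq_n^\dagger=\mathrm{id}_{A_n}$ and $q_nq_k^\dagger=0$ for $n\neq k$. *)

(* Defs.v *)
Set Implicit Arguments.
Unset Strict Implicit.
Unset Printing Implicit Defensive.

Declare Scope cat_scope.
Delimit Scope cat_scope with cat.

Record category := Category {
  ob :> Type;
  hom : ob -> ob -> Type;
  idm : forall A : ob, hom A A;
  comp : forall A B C : ob, hom B C -> hom A B -> hom A C;
  comp_assoc : forall (A B C D : ob) (h : hom C D) (g : hom B C) (f : hom A B),
    comp h (comp g f) = comp (comp h g) f;
  comp_idl : forall (A B : ob) (f : hom A B), comp (idm B) f = f;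
  comp_idr : forall (A B : ob) (f : hom A B), comp f (idm A) = f }.

Arguments hom {c} A B.
Arguments idm {c} A.
Arguments comp {c A B C} g f.

Notation "g ∘ f" := (comp g f) (at level 40, left associativity) : cat_scope.
Open Scope cat_scope.

Record dagger_category := DaggerCategory {
  dcat :> category;
  dag : forall A B : dcat, hom A B -> hom B A;
  dag_id : forall A : dcat, dag (idm A) = idm A;
  dag_comp : forall (A B C : dcat) (g : hom B C) (f : hom A B),
    dag (g ∘ f) = dag f ∘ dag g;
  dagK : forall (A B : dcat) (f : hom A B), dag (dag f) = f }.

Arguments dag {d A B} f.

Notation "f ^†" := (dag f) (at level 1, left associativity, format "f ^†")
  : cat_scope.

(* Such a family is unique, hence automatically preserved by any dagger. *)
Record zero_morphisms (C : category) := ZeroMorphisms {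
  zero : forall A B : C, hom A B;
  comp_zerol : forall (A B D : C) (f : hom A B), zero B D ∘ f = zero A D;
  comp_zeror : forall (A B D : C) (g : hom B D), g ∘ zero A B = zero A D }.

Section Category.
Variable C : category.

Definition monic (A B : C) (f : hom A B) : Prop :=
  forall (X : C) (g h : hom X A), f ∘ g = f ∘ h -> g = h.

Definition epic (A B : C) (f : hom A B) : Prop :=
  forall (X : C) (g h : hom B X), g ∘ f = h ∘ f -> g = h.

Definition bimorphism (A B : C) (f : hom A B) : Prop := monic f /\ epic f.

Definition is_product (A1 A2 P : C) (p1 : hom P A1) (p2 : hom P A2) : Prop :=
  forall (X : C) (f1 : hom X A1) (f2 : hom X A2),
    exists! h : hom X P, p1 ∘ h = f1 /\ p2 ∘ h = f2.

Definition is_coproduct (A1 A2 S : C) (i1 : hom A1 S) (i2 : hom A2 S) : Prop :=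
  forall (X : C) (f1 : hom A1 X) (f2 : hom A2 X),
    exists! h : hom S X, h ∘ i1 = f1 /\ h ∘ i2 = f2.

Definition is_biproduct (z : zero_morphisms C) (A1 A2 S : C)
    (p1 : hom S A1) (p2 : hom S A2) (i1 : hom A1 S) (i2 : hom A2 S) : Prop :=
  is_product p1 p2 /\ is_coproduct i1 i2 /\
  p1 ∘ i1 = idm A1 /\ p2 ∘ i2 = idm A2 /\
  p2 ∘ i1 = zero z A1 A2 /\ p1 ∘ i2 = zero z A2 A1.

Definition has_biproduct (z : zero_morphisms C) (A1 A2 : C) : Prop :=
  exists (S : C) (p1 : hom S A1) (p2 : hom S A2) (i1 : hom A1 S) (i2 : hom A2 S),
    is_biproduct z p1 p2 i1 i2.

End Category.

Section DaggerCategory.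
Variable C : dagger_category.

Definition partial_isometry (A B : C) (f : hom A B) : Prop := f = f ∘ f^† ∘ f.

Definition dagger_monic (A B : C) (f : hom A B) : Prop := f^† ∘ f = idm A.

Definition self_adjoint (A : C) (f : hom A A) : Prop := f = f^†.

Definition projection (A : C) (f : hom A A) : Prop := f = f^† /\ f = f ∘ f.

Definition polar_decomposition (A B : C) (f p : hom A B)
    (i : hom A A) (j : hom B B) : Prop :=
  f = p ∘ i /\ f = j ∘ p /\ partial_isometry p /\
  (self_adjoint i /\ bimorphism i) /\ (self_adjoint j /\ bimorphism j).

Definition admits_polar_decomposition : Prop :=
  forall (A B : C) (f : hom A B),
    exists (p : hom A B) (i : hom A A) (j : hom B B), polar_decomposition f p i j.

Definition dagger_splitting (A I : C) (p : hom A A) (i : hom I A) : Prop :=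
  dagger_monic i /\ p = i ∘ i^†.

Definition has_dagger_splittings_of_projections : Prop :=
  forall (A : C) (p : hom A A), projection p ->
    exists (I : C) (i : hom I A), dagger_splitting p i.

Definition is_dagger_product (A1 A2 P : C) (q1 : hom P A1) (q2 : hom P A2) : Prop :=
  is_product q1 q2 /\ partial_isometry q1 /\ partial_isometry q2 /\
  (q1^† ∘ q1) ∘ (q2^† ∘ q2) = (q2^† ∘ q2) ∘ (q1^† ∘ q1).

Definition has_dagger_product (A1 A2 : C) : Prop :=
  exists (P : C) (q1 : hom P A1) (q2 : hom P A2), is_dagger_product q1 q2.

End DaggerCategory.

Arguments admits_polar_decomposition C : clear implicits.
Arguments has_dagger_splittings_of_projections C : clear implicits.

(* Main.v *)
Require Import Defs.

(** The legs of a biproduct [S] of [A1] and [A2] are retractions and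
    coretractions, and polar decomposition turns a retraction into a
    coisometry up to an isomorphism ([retraction_factorization]): in
    [f = j ∘ p] the bimorphism [j] inherits a section from [f], hence is
    invertible, and the partial isometry [p] is epic, hence [p ∘ p^† = 1].

    Applied to [i1^†] and to [p2], this gives coisometries [a : S -> A1] and
    [b : S -> A2]. They are orthogonal, [b ∘ a^† = 0], because up to
    isomorphisms this composite is [p2 ∘ i1]. So [a] and [b] satisfy the
    equations of the projections of a dagger product, but [S] need not be a
    product along them. The comparison [m = <a, b> : S -> S] measures this
    failure. It has a section, namely the cotuple [n = [a^†, b^†]], since
    [p_k ∘ m ∘ n ∘ i_l] is [1] or [0] by these equations. Factoring
    [m = j ∘ p] by the same lemma yields an automorphism [j] of [S] with
    [j ∘ j^† = m ∘ m^†]. The morphisms [p1 ∘ j] and [p2 ∘ j] are then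
    projections of a product because [j] is invertible, and they have the same
    inner products as [a = p1 ∘ m] and [b = p2 ∘ m], so they form a dagger
    product ([dagger_product_of_orthogonal_coisometries]). *)

Set Implicit Arguments.
Unset Strict Implicit.

Lemma product_ext (C : category) (A1 A2 S : C) (p1 : hom S A1) (p2 : hom S A2)
    (X : C) (g h : hom X S) :
  is_product p1 p2 -> p1 ∘ g = p1 ∘ h -> p2 ∘ g = p2 ∘ h -> g = h.
Proof.
intros prodS e1 e2.
destruct (prodS _ (p1 ∘ h) (p2 ∘ h)) as [k [_ uniq]].
transitivity k; [symmetry|]; apply uniq; auto.
Qed.

Lemma product_precomp_iso (C : category) (A1 A2 S : C)
    (p1 : hom S A1) (p2 : hom S A2) (T : C) (j : hom T S) (k : hom S T) :
  is_product p1 p2 -> j ∘ k = idm S -> k ∘ j = idm T ->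
  is_product (p1 ∘ j) (p2 ∘ j).
Proof.
intros prodS jk kj X f1 f2.
destruct (prodS _ f1 f2) as [h [[h1 h2] uniq]].
exists (k ∘ h); split.
- split; rewrite comp_assoc, <- (comp_assoc _ j k), jk, comp_idr; assumption.
- intros g [g1 g2].
  rewrite (uniq (j ∘ g)) by (split; rewrite comp_assoc; assumption).
  now rewrite comp_assoc, kj, comp_idl.
Qed.

Lemma coproduct_ext (C : category) (A1 A2 S : C) (i1 : hom A1 S)
    (i2 : hom A2 S) (X : C) (g h : hom S X) :
  is_coproduct i1 i2 -> g ∘ i1 = h ∘ i1 -> g ∘ i2 = h ∘ i2 -> g = h.
Proof.
intros coprodS e1 e2.
destruct (coprodS _ (h ∘ i1) (h ∘ i2)) as [k [_ uniq]].
transitivity k; [symmetry|]; apply uniq; auto.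
Qed.

Lemma dag_zero (C : dagger_category) (z : zero_morphisms C) (A B : C) :
  (zero z A B)^† = zero z B A.
Proof.
now rewrite <- (comp_zerol z B (zero z B A)^†), dag_comp, dagK, comp_zerol.
Qed.

(** The polar decomposition supplies [j] as a monic; the section of [f] makes
    it split epic as well. *)
Lemma retraction_factorization (C : dagger_category)
    (polarC : admits_polar_decomposition C)
    (A B : C) (f : hom A B) (s : hom B A) :
  f ∘ s = idm B ->
  exists (p : hom A B) (j k : hom B B),
    f = j ∘ p /\ p ∘ p^† = idm B /\ j ∘ k = idm B /\ k ∘ j = idm B.
Proof.
intros fs.
destruct (polarC _ _ f)
  as [p [i [j [fpi [fjp [p_pi [[_ [_ _]] [_ [j_monic _]]]]]]]]].
assert (p_epic : epic p).
{ intros X g h e.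
  rewrite <- (comp_idr g), <- (comp_idr h), <- fs, fpi.
  now rewrite !comp_assoc, e. }
assert (jps : j ∘ (p ∘ s) = idm B) by now rewrite comp_assoc, <- fjp.
exists p, j, (p ∘ s); repeat split; trivial.
- now apply p_epic; rewrite comp_idl, <- p_pi.
- now apply j_monic; rewrite comp_assoc, jps, comp_idl, comp_idr.
Qed.

(** For coisometries the commutation of [q1^† ∘ q1] and [q2^† ∘ q2] follows
    from orthogonality: both composites vanish. *)
Lemma is_dagger_product_of_orthogonal (C : dagger_category)
    (z : zero_morphisms C) (A1 A2 P : C) (q1 : hom P A1) (q2 : hom P A2) :
  is_product q1 q2 -> q1 ∘ q1^† = idm A1 -> q2 ∘ q2^† = idm A2 ->
  q2 ∘ q1^† = zero z A1 A2 -> is_dagger_product q1 q2.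
Proof.
intros prodP q11 q22 q21.
assert (q12 : q1 ∘ q2^† = zero z A2 A1)
  by now rewrite <- (dag_zero z A1 A2), <- q21, dag_comp, dagK.
unfold is_dagger_product, partial_isometry.
rewrite q11, q22, !comp_idl; repeat split; trivial.
rewrite !comp_assoc, <- (comp_assoc q1^† q1), <- (comp_assoc q2^† q2), q12, q21.
now rewrite !comp_zeror, !comp_zerol.
Qed.

(** Replacing the comparison [m = <a, b>] by the invertible factor [j] of
    [m = j ∘ p] keeps every inner product, as [m ∘ m^† = j ∘ j^†]. *)
Lemma dagger_product_of_orthogonal_coisometries (C : dagger_category)
    (z : zero_morphisms C) (polarC : admits_polar_decomposition C)
    (A1 A2 S : C) (p1 : hom S A1) (p2 : hom S A2)
    (i1 : hom A1 S) (i2 : hom A2 S) (T : C) (a : hom T A1) (b : hom T A2) :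
  is_biproduct z p1 p2 i1 i2 ->
  a ∘ a^† = idm A1 -> b ∘ b^† = idm A2 -> b ∘ a^† = zero z A1 A2 ->
  has_dagger_product A1 A2.
Proof.
intros [prodS [coprodS [p1i1 [p2i2 [p2i1 p1i2]]]]] aa bb ba.
assert (ab : a ∘ b^† = zero z A2 A1)
  by now rewrite <- (dag_zero z A1 A2), <- ba, dag_comp, dagK.
destruct (prodS _ a b) as [m [[p1m p2m] _]].
destruct (coprodS _ a^† b^†) as [n [[ni1 ni2] _]].
assert (mn : m ∘ n = idm S).
{ apply (coproduct_ext coprodS); rewrite <- comp_assoc, comp_idl;
    rewrite ?ni1, ?ni2; apply (product_ext prodS); rewrite comp_assoc;
    rewrite ?p1m, ?p2m; congruence. }
destruct (retraction_factorization polarC mn) as [p [j [k [mjp [pp [jk kj]]]]]].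
assert (inner : forall (X Y : C) (f : hom S X) (g : hom S Y),
  (f ∘ j) ∘ (g ∘ j)^† = (f ∘ m) ∘ (g ∘ m)^†).
{ intros X Y f g.
  rewrite mjp, !dag_comp, !comp_assoc.
  now rewrite <- (comp_assoc _ p), pp, comp_idr. }
exists S, (p1 ∘ j), (p2 ∘ j).
apply (is_dagger_product_of_orthogonal (z := z)).
- exact (product_precomp_iso prodS jk kj).
- now rewrite inner, p1m.
- now rewrite inner, p2m.
- now rewrite inner, p1m, p2m.
Qed.

Theorem theorem8p8 (C : dagger_category) (z : zero_morphisms C)
    (polarC : admits_polar_decomposition C)
    (splitC : has_dagger_splittings_of_projections C)
    (A1 A2 : C) (biprod : has_biproduct z A1 A2) :
  has_dagger_product A1 A2.
Proof.
destruct biprod as [S [p1 [p2 [i1 [i2 bip]]]]].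
pose proof bip as [_ [_ [p1i1 [p2i2 [p2i1 _]]]]].
assert (i1p1 : i1^† ∘ p1^† = idm A1) by now rewrite <- dag_comp, p1i1, dag_id.
destruct (retraction_factorization polarC i1p1)
  as [a [j [j' [i1ja [aa [_ j'j]]]]]].
destruct (retraction_factorization polarC p2i2)
  as [b [k [k' [p2kb [bb [_ k'k]]]]]].
apply (dagger_product_of_orthogonal_coisometries polarC bip aa bb).
(* The isomorphisms [j'] and [k'] carry [i1] and [p2] to [a^†] and [b]. *)
assert (a_i1 : a^† = i1 ∘ j'^†).
{ rewrite <- (dagK i1), <- dag_comp, i1ja.
  now rewrite comp_assoc, j'j, comp_idl. }
assert (b_p2 : b = k' ∘ p2) by now rewrite p2kb, comp_assoc, k'k, comp_idl.
rewrite a_i1, b_p2, comp_assoc, <- (comp_assoc k'), p2i1.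
now rewrite comp_zeror, comp_zerol.
Qed.
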